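(* Let $X=(\Omega,\mathcal F,P)$ be an arbitrary probability space, let $E$ be a finite set, let $h:[0,1]\to[0,1]$ be a measurable function, and let $A\in\mathcal F^E$. Then there exists a measurable event $B$ in the Lebesgue product space $\mathcal L^E$ such that $\lambda^E(B)=\mathbb P(A)$ and $I_B^h(e)=I_A^h(e)$ for every $e\in E$.
   Context: For a probability space $X=(\Omega,\mathcal F,P)$ and a finite set $E$, $X^E=(\Omega^E,\mathcal F^E,\mathbb P=P^E)$ denotes the product probability space of $|E|$ copies of $X$ indexed by $E$ ($\mathcal F^E$ is the product $\sigma$-field; no completeness or separability is assumed). For $e\in E$ and $\psi\in\Omega^{E\setminus\{e\}}$, the fibre is $F_\psi=\{\omega\in\Omega^E:\omega(f)=\psi(f)\text{ for } f\neq e\}\simeq\{\psi\}\times\Omega$. Via the identification $F_\psi\simeq\Omega$ (by $\omega\mapsto\omega(e)$), for $A\in\mathcal F^E$ write $P(A\cap F_\psi)$ for the $P$-measure of the section $\{\omega(e):\omega\in A\cap F_\psi\}\subseteq\Omega$. For a measurable function $h:[0,1]\to[0,1]$ (measurable with respect to Borel $\sigma$-fields), the $h$-influence of $e\in E$ on $A\in\mathcal F^E$ is $$I_A^h(e)=P^{E\setminus\{e\}}\bigl(h(P(A\cap F_\psi))\bigr)=\int_{\Omega^{E\setminus\{e\}}}h\bigl(P(A\cap F_\psi)\bigr)\,dP^{E\setminus\{e\}}(\psi),$$ where $\mu(f)$ denotes the expectation of $f$ under the probability measure $\mu$. The notation does not display the underlying space: $h$-influences of $A\in\mathcal F^E$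 are computed in $X^E$, and $h$-influences of an event $B$ of $\mathcal L^E$ are computed by the same definition with $X$ replaced by $\mathcal L$. $\mathcal L=([0,1],\mathcal B[0,1],\lambda)$ is the Lebesgue probability space: the unit interval with its Borel $\sigma$-field and Lebesgue measure $\lambda$. $\mathcal L^E$ is its $E$-fold product, with measure $\lambda^E$. *)

(* Defs.v *)
From HB Require Import structures.
From mathcomp Require Import all_boot all_order all_algebra.
From mathcomp Require Import all_classical all_reals all_analysis.

Set Implicit Arguments.
Unset Strict Implicit.
Unset Printing Implicit Defensive.

Import Order.TTheory GRing.Theory Num.Theory.
Import numFieldNormedType.Exports.

Local Open Scope classical_set_scope.
Local Open Scope ring_scope.

Definition power (E : finType) (T : Type) : Type := E -> T.

HB.instance Definition _ (E : finType) (T : pointedType) :=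
  Pointed.copy (power E T) (E -> T).

Definition power_display : measure_display -> measure_display.
Proof. exact. Qed.

Section power_measurable.
Context d (T : measurableType d) (E : finType).

Definition cylinders : set (set (power E T)) :=
  \bigcup_(e : E) preimage_set_system setT (fun w : power E T => w e) measurable.

Let power_set0 : <<s cylinders >> set0.
Proof. exact: sigma_algebra0. Qed.

Let power_setC A : <<s cylinders >> A -> <<s cylinders >> (~` A).
Proof. exact: sigma_algebraC. Qed.

Let power_bigcup (F : (set (power E T))^nat) :
  (forall i, <<s cylinders >> (F i)) -> <<s cylinders >> (\bigcup_i (F i)).
Proof. exact: sigma_algebra_bigcup. Qed.

HB.instance Definition _ := @isMeasurable.Build (power_display d) (power E T)
  <<s cylinders >> power_set0 power_setC power_bigcup.

Lemma measurable_coord (e : E) :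
  measurable_fun [set: power E T] (fun w : power E T => w e).
Proof.
move=> _ Y mY; apply: sub_sigma_algebra.
by exists e => //; exists Y.
Qed.

Lemma measurable_powerP d' (S : measurableType d') (g : S -> power E T) :
  measurable_fun setT g <-> forall e, measurable_fun setT (fun x => g x e).
Proof.
split=> [mg e|mg].
  exact: (measurableT_comp (measurable_coord e) mg).
apply: (@measurability _ _ _ _ setT g cylinders) => //.
move=> _ [_ [e _ [Y mY <-]] <-].
by rewrite setTI; exact: mg.
Qed.

End power_measurable.

Section power_probability.
Context d (T : measurableType d) (R : realType) (P : probability T R).

Definition tuple_cons n (p : T * n.-tuple T) : n.+1.-tuple T :=
  [tuple of p.1 :: p.2].

Lemma measurable_tuple_cons n : measurable_fun setT (@tuple_cons n).
Proof. exact: measurable_cons measurable_fst measurable_snd. Qed.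

HB.instance Definition _ n :=
  isMeasurableFun.Build _ _ _ _ (@tuple_cons n) (@measurable_tuple_cons n).

(* The product measure is built by iterating the binary product along the
   enumeration of [E]; [power_prob_box] shows that the result satisfies the
   product rule on boxes, which determines it. *)
Fixpoint tuple_prob n : probability (n.-tuple T) R :=
  if n is m.+1 then distribution (P \x tuple_prob m)%E (@tuple_cons m)
  else dirac [tuple].

Variable E : finType.

Definition power_of_tuple (t : #|E|.-tuple T) : power E T :=
  fun e => tnth t (enum_rank e).

Lemma measurable_power_of_tuple : measurable_fun setT power_of_tuple.
Proof. by apply/measurable_powerP => e; exact: measurable_tnth. Qed.

HB.instance Definition _ := isMeasurableFun.Build _ _ _ _ power_of_tuple
  measurable_power_of_tuple.

Definition power_prob : probability (power E T) R :=
  distribution (tuple_prob #|E|) power_of_tuple.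

End power_probability.

Lemma tuple_prob_box d (T : measurableType d) (R : realType)
    (P : probability T R) n (B : 'I_n -> set T) :
  (forall i, measurable (B i)) ->
  tuple_prob P n [set t | forall i, B i (tnth t i)] = (\prod_(i < n) P (B i))%E.
Proof.
elim: n B => [|n IH] B mB.
  by rewrite big_ord0 /= diracE mem_set//= => -[].
set C := [set t : n.-tuple T | forall i, B (lift ord0 i) (tnth t i)].
have CE : C = \bigcap_(i in [set: 'I_n])
    ((fun t : n.-tuple T => tnth t i) @^-1` B (lift ord0 i)).
  by apply/seteqP; split => t /= H i; [move=> _|]; exact: H.
have mC : measurable C.
  rewrite CE; apply: fin_bigcap_measurable => [|i _]; first exact: finite_finset.
  by rewrite -[X in measurable X]setTI; exact: measurable_tnth.
have BE : @tuple_cons d T n @^-1` [set t | forall i, B i (tnth t i)] =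
    B ord0 `*` C.
  apply/seteqP; split => -[x t] /=.
    move=> H; split=> [|i]; first exact: (H ord0).
    by have := H (lift ord0 i); rewrite tnthS.
  by move=> [H0 H] i; case: (unliftP ord0 i) => [j|] ->//; rewrite tnthS; apply: H.
rewrite big_ord_recl /= /distribution /pushforward/= BE product_measure1E//.
by congr (_ * _)%E; apply: IH.
Qed.

Lemma power_prob_box d (T : measurableType d) (R : realType)
    (P : probability T R) (E : finType) (B : E -> set T) :
  (forall e, measurable (B e)) ->
  power_prob P E [set w | forall e, B e (w e)] = (\prod_(e : E) P (B e))%E.
Proof.
move=> mB; rewrite /power_prob /= /distribution /pushforward.
have -> : @power_of_tuple d T E @^-1` [set w | forall e, B e (w e)] =
    [set t : #|E|.-tuple T | forall i, B (enum_val i) (tnth t i)].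
  apply/seteqP; split => t /= H i.
    by have := H (enum_val i); rewrite /power_of_tuple enum_valK.
  by have := H (enum_rank i); rewrite enum_rankK.
rewrite [RHS](reindex (@enum_val E predT))/=; last first.
  by exists enum_rank => i _; [exact: enum_valK|exact: enum_rankK].
exact: tuple_prob_box.
Qed.

Section influence.
Context d (T : measurableType d) (R : realType) (P : probability T R).
Context (E : finType).

(* [power {f : E | f != e} T] is the space of configurations off [e]. *)
Definition fibre (e : E) (psi : power {f : E | f != e} T) : set (power E T) :=
  [set w | forall f : {f : E | f != e}, w (val f) = psi f].

Definition fibre_prob (A : set (power E T)) (e : E)
    (psi : power {f : E | f != e} T) : \bar R :=
  P [set w e | w in A `&` fibre psi].

(* A function from [0, 1] to [0, 1] is represented by [h : R -> R]: for
   measurable [A] the fibre probabilities lie in [0, 1], so the values of [h]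
   outside [0, 1] are irrelevant. *)
Definition influence (h : R -> R) (A : set (power E T)) (e : E) : \bar R :=
  (\int[power_prob P {f : E | f != e}]_psi (h (fine (fibre_prob A psi)))%:E)%E.

End influence.

Definition unit_interval (R : realType) : Type := set_type (`[0, 1]%classic : set R).

Section unit_interval_measurable.
Variable R : realType.
Local Notation I := (unit_interval R).

HB.instance Definition _ := Topological.copy I (set_type (`[0, 1]%classic : set R)).

Let in01 : (0 : R) \in `[0, 1]%classic.
Proof. by rewrite inE /= in_itv /= lexx ler01. Qed.

HB.instance Definition _ := isPointed.Build I (exist _ 0 in01 : I).

Let borel_set0 : <<s @open I >> set0.
Proof. exact: sigma_algebra0. Qed.

Let borel_setC B : <<s @open I >> B -> <<s @open I >> (~` B).
Proof. exact: sigma_algebraC. Qed.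

Let borel_bigcup (F : (set I)^nat) :
  (forall i, <<s @open I >> (F i)) -> <<s @open I >> (\bigcup_i (F i)).
Proof. exact: sigma_algebra_bigcup. Qed.

HB.instance Definition _ := @isMeasurable.Build (sigma_display (@open I)) I
  <<s @open I >> borel_set0 borel_setC borel_bigcup.

Let ival (x : I) : R := set_val x.

Let range_ival : range ival = `[0, 1]%classic.
Proof.
apply/seteqP; split => [_ [x _ <-]|x x01]; first exact: set_valP.
by exists (exist _ x (mem_set x01)).
Qed.

Let ival_inj : injective ival.
Proof. exact: val_inj. Qed.

Lemma measurable_unit_interval (B : set I) :
  measurable B -> measurable [set (set_val x : R) | x in B].
Proof.
move: B; apply: smallest_sub => [|B [U oU <-]].
  split=> [|B mB|F mF].
  - by rewrite /= image_set0.
  - rewrite /= setTD.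
    have -> : ival @` (~` B) = (`[0, 1]%classic : set R) `\` ival @` B.
      apply/seteqP; split => [_ [x nBx <-]|x [x01 nBx]].
        split; first exact: set_valP.
        by move=> [y By /ival_inj yx]; apply: nBx; rewrite -yx.
      move: x01; rewrite -range_ival => -[y _ yx]; exists y => // By.
      by apply: nBx; exists y.
    by apply: measurableD => //; exact: measurable_itv.
  - by rewrite /= image_bigcup; apply: bigcup_measurable => i _; exact: mF.
have -> : [set (set_val x : R) | x in (set_val : I -> R) @^-1` U] = (`[0, 1]%classic : set R) `&` U.
  apply/seteqP; split => [_ [x Ux <-]|x []].
    by split => //; exact: set_valP.
  by move=> x01 Ux; exists (exist _ x (mem_set x01)).
by apply: measurableI; [exact: measurable_itv|exact: measurable_realfun.open_measurable].
Qed.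

Definition unit_lebesgue (B : set I) : \bar R :=
  lebesgue_measure [set (set_val x : R) | x in B].

Let unit_lebesgue0 : unit_lebesgue set0 = 0%E.
Proof. by rewrite /unit_lebesgue image_set0 measure0. Qed.

Let unit_lebesgue_ge0 B : (0 <= unit_lebesgue B)%E.
Proof. exact: measure_ge0. Qed.

Let unit_lebesgue_sigma_additive : semi_sigma_additive unit_lebesgue.
Proof.
move=> F mF tF mUF; rewrite /unit_lebesgue image_bigcup.
apply: measure_semi_sigma_additive => [i||].
- exact: measurable_unit_interval.
- apply/trivIsetP => i j _ _ ij; apply/seteqP; split => // x [].
  move=> [y Fy <-] [z Fz /ival_inj zy]; move/trivIsetP : tF => /(_ _ _ Logic.I Logic.I ij).
  by move=> /seteqP[+ _] => /(_ y); apply; split => //; rewrite -zy.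
- by rewrite -image_bigcup; exact: measurable_unit_interval.
Qed.

HB.instance Definition _ := isMeasure.Build _ _ _ unit_lebesgue
  unit_lebesgue0 unit_lebesgue_ge0 unit_lebesgue_sigma_additive.

Let unit_lebesgue_setT : unit_lebesgue setT = 1%E.
Proof.
by rewrite /unit_lebesgue range_ival lebesgue_measure_itv/= lte01 oppr0 adde0.
Qed.

HB.instance Definition _ := Measure_isProbability.Build _ _ _ unit_lebesgue
  unit_lebesgue_setT.

End unit_interval_measurable.

(* Main.v *)
(* A lies in the product sigma-field generated by the coordinate copies of
   countably many events C_n, so A is the pullback of a Borel set A' of R^E
   under the coordinatewise action of g := sum_n 1_{C_n} / 3^(n+1).  If q is the
   quantile function of the law of g, then B := pullback of A' under the
   coordinatewise action of q works: product measures and influences commute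
   with pullback along a map that transports one probability to the other. *)
Require Import Defs.
From HB Require Import structures.
From mathcomp Require Import all_boot all_order all_algebra.
From mathcomp Require Import all_classical all_reals all_analysis.
From mathcomp Require Import measurable_realfun lra.

Set Implicit Arguments.
Unset Strict Implicit.
Unset Printing Implicit Defensive.

Import Order.TTheory GRing.Theory Num.Theory.
Import numFieldNormedType.Exports.

Local Open Scope classical_set_scope.
Local Open Scope ring_scope.

(** * Coordinatewise maps and measurable boxes *)

Definition power_map (S T : Type) (f : S -> T) (E : finType) (w : power E S) :
  power E T := f \o w.
Arguments power_map {S T} f {E} w.

Lemma measurable_power_map d1 d2 (S : measurableType d1) (T : measurableType d2)
    (f : S -> T) (E : finType) :
  measurable_fun setT f -> measurable_fun setT (@power_map S T f E).
Proof.
move=> mf; apply/measurable_powerP => e.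
exact: measurableT_comp mf (measurable_coord e).
Qed.

Definition boxes d (T : measurableType d) (E : finType) : set (set (power E T)) :=
  [set [set w : power E T | forall e, B e (w e)] |
    B in [set B : E -> set T | forall e, measurable (B e)]].

Arguments boxes {d} T E _.

(** A cylinder is a box with at most one side different from the whole space; conversely, as [E] is
    finite, a box is a finite intersection of cylinders. Boxes, unlike cylinders, are closed under
    intersection and carry the product rule, so they can serve as a generating pi-system. *)
Lemma measurable_boxes d (T : measurableType d) (E : finType) :
  (@measurable _ (power E T)) = <<s boxes T E >>.
Proof.
apply/seteqP; split; apply: smallest_sub; try exact: smallest_sigma_algebra.
  move=> _ [e _ [Y mY <-]]; apply: sub_sigma_algebra.
  exists (fun e' => if e' == e then Y else setT) => [e'|]; first by case: ifP.
  apply/seteqP; split => [w /(_ e)|w [_ Yw] e']; first by rewrite eqxx.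
  by case: eqP => // ->.
move=> _ [B mB <-]; have -> : [set w : power E T | forall e, B e (w e)] =
    \bigcap_(e in [set: E]) ((fun w : power E T => w e) @^-1` B e).
  by apply/seteqP; split => w /= H i; [move=> _|]; exact: H.
apply: (@fin_bigcap_measurable _ (power E T)) => [|e _]; first exact: finite_finset.
by rewrite -[X in measurable X]setTI; exact: (measurable_coord e).
Qed.

Lemma setI_closed_boxes d (T : measurableType d) (E : finType) :
  setI_closed (boxes T E).
Proof.
move=> _ _ [B mB <-] [C mC <-]; exists (fun e => B e `&` C e) => [e|].
  exact: measurableI.
apply/seteqP; split => w /= => [H|[Bw Cw] e //].
by split=> e; case: (H e).
Qed.

(** * Fibres as sections of a product set *)

Definition extend (E : finType) (T : Type) (e : E)
    (p : power {f : E | f != e} T * T) : power E T :=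
  fun f => if insub f is Some g then p.1 g else p.2.

Lemma extend_off (E : finType) (T : Type) (e : E)
    (p : power {f : E | f != e} T * T) (g : {f : E | f != e}) :
  extend p (val g) = p.1 g.
Proof. by rewrite /extend valK. Qed.

Lemma extend_at (E : finType) (T : Type) (e : E)
    (p : power {f : E | f != e} T * T) : extend p e = p.2.
Proof. by rewrite /extend insubF// eqxx. Qed.

Lemma measurable_extend d (T : measurableType d) (E : finType) (e : E) :
  measurable_fun setT (@extend E T e).
Proof.
apply/measurable_powerP => f; rewrite /extend; case: insub => [g|].
  exact: measurableT_comp (measurable_coord g) measurable_fst.
exact: measurable_snd.
Qed.

Lemma measurable_extend_preimage d (T : measurableType d) (E : finType) (e : E)
    (A : set (power E T)) : measurable A -> measurable (@extend E T e @^-1` A).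
Proof.
by move=> mA; rewrite -[X in measurable X]setTI; exact: measurable_extend.
Qed.

(** [extend] identifies {psi} x T with the fibre: a point of the fibre is determined by its value at
    [e]. Fibre probabilities thereby become measures of sections, whose measurability in [psi] is a
    standard fact about products. *)
Lemma fibre_section d (T : measurableType d) (E : finType) (A : set (power E T))
    (e : E) (psi : power {f : E | f != e} T) :
  [set w e | w in A `&` fibre psi] = xsection (@extend E T e @^-1` A) psi.
Proof.
apply/seteqP; split => [_ [w [Aw wpsi] <-]|x].
  rewrite xsectionE /= (_ : extend _ = w)//; apply/funext => f.
  rewrite /extend; case: insubP => [g _ <-|]; first by rewrite wpsi.
  by rewrite negbK => /eqP ->.
rewrite xsectionE /= => Ax; exists (extend (psi, x)); last exact: extend_at.
by split => // g; exact: extend_off.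
Qed.

Lemma measurable_fibre_prob d (T : measurableType d) (R : realType)
    (P : probability T R) (E : finType) (A : set (power E T)) (e : E) :
  measurable A ->
  measurable_fun setT (@fibre_prob _ T R P E A e).
Proof.
move=> mA.
rewrite (_ : fibre_prob P A (e := e) = P \o xsection (@extend E T e @^-1` A)); last first.
  by apply/funext => psi /=; rewrite /fibre_prob fibre_section.
by apply: measurable_fun_xsection; exact: measurable_extend_preimage.
Qed.

(** * Transfer of product probabilities and influences along [f], where [P] is the image of [Q]
    under [f] *)

Section transfer.
Context d1 d2 (S : measurableType d1) (T : measurableType d2) (R : realType).
Variables (Q : probability S R) (P : probability T R).
Variables (f : S -> T) (mf : measurable_fun setT f).
Hypothesis PQ : forall D, measurable D -> P D = Q (f @^-1` D).

Let power_map_mfun (E : finType) : {mfun power E S >-> power E T} :=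
  HB.pack (@power_map S T f E)
    (isMeasurableFun.Build _ _ _ _ _ (measurable_power_map mf)).

(** The image of the power of [Q] is again a probability, and by the product rule it agrees with the
    power of [P] on boxes; a probability is determined by its values on this pi-system. *)
Lemma power_prob_map (E : finType) (A : set (power E T)) : measurable A ->
  power_prob P E A = power_prob Q E (power_map f @^-1` A).
Proof.
pose mu : probability (power E T) R := distribution (power_prob Q E) (power_map_mfun E).
move=> mA; rewrite [RHS](_ : _ = mu A)//.
apply: (measure_unique (boxes T E) (fun=> setT)) => //.
- exact: measurable_boxes.
- exact: setI_closed_boxes.
- move=> _; exists (fun=> setT) => //; exact/seteqP.
- by apply/seteqP; split => // w _; exists 0%N.
- move=> _ [B mB <-]; transitivity (\prod_(e : E) P (B e))%E.
    exact: power_prob_box.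
  transitivity (\prod_(e : E) Q (f @^-1` B e))%E.
    by apply: eq_bigr => e _; exact: PQ.
  apply/esym; apply: (power_prob_box Q (B := fun e => f @^-1` B e)) => e.
  by rewrite -[X in measurable X]setTI; exact: mf.
- by move=> _; rewrite -ge0_fin_numE// fin_num_measure.
Qed.

(** Applying [f] coordinatewise commutes with [extend], so the section of the pulled-back event at
    [psi] is the [f]-preimage of the section of [A] at the image of [psi]. *)
Lemma fibre_prob_map (E : finType) (A : set (power E T)) (e : E)
    (psi : power {f : E | f != e} S) : measurable A ->
  fibre_prob Q (power_map f @^-1` A) psi = fibre_prob P A (power_map f psi).
Proof.
move=> mA; rewrite /fibre_prob !fibre_section PQ.
  congr (Q _); rewrite !xsectionE; apply/seteqP.
  have E1 x : power_map f (extend (psi, x)) = extend (power_map f psi, f x).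
    by apply/funext => g; rewrite /power_map /extend /=; case: insub.
  by split=> x /=; rewrite E1.
by apply: measurable_xsection; exact: measurable_extend_preimage.
Qed.

(** Change of variables: the measure off [e] on the [T] side is the image of the one on the [S]
    side, and the integrands correspond by [fibre_prob_map]. *)
Lemma influence_map (h : R -> R) (E : finType) (A : set (power E T)) (e : E) :
  (forall x : R, 0 <= x <= 1 -> 0 <= h x <= 1) ->
  measurable_fun (`[0, 1]%classic : set R) h -> measurable A ->
  influence Q h (power_map f @^-1` A) e = influence P h A e.
Proof.
move=> h01 mh mA; rewrite /influence.
(* The bounds and the measurability of [h] are given only on [0, 1], so fibre probabilities must
   first be placed there. *)
have p01 (psi : power {f | f != e} T) : 0 <= fine (fibre_prob P A psi) <= 1.
  have mF : measurable (xsection (@extend E T e @^-1` A) psi).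
    by apply: measurable_xsection; exact: measurable_extend_preimage.
  rewrite -!lee_fin /fibre_prob fibre_section fineK ?fin_num_measure//.
  by rewrite measure_ge0 probability_le1.
have mp : measurable_fun setT (fun psi => fine (@fibre_prob _ T R P E A e psi)).
  exact: measurableT_comp (measurable_fibre_prob P mA).
rewrite [RHS](eq_measure_integral
  (distribution (power_prob Q {f | f != e}) (power_map_mfun {f | f != e}))); last first.
  by move=> D mD _; exact: power_prob_map.
rewrite [RHS]ge0_integral_distribution//; last 2 first.
- apply/measurable_EFinP; apply: (measurable_comp (measurable_itv _) _ mh mp).
  by move=> _ [psi _ <-]; rewrite /= in_itv /= p01.
- by move=> psi; rewrite lee_fin; case/andP: (h01 _ (p01 psi)).
by apply: eq_integral => psi _ /=; rewrite fibre_prob_map.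
Qed.

End transfer.

(** * Coding a sequence of events by one real number in base 3 *)

Section ternary_code.
Variable R : realType.

(** This is the sum over k < n of b_k / 3^(k+1), in Horner form so that the recursion removes the
    first digit. *)
Fixpoint ternary_prefix (n : nat) (b : nat -> bool) : R :=
  if n is m.+1 then ((b 0%N)%:R + ternary_prefix m (b \o S)) / 3 else 0.

Lemma ternary_prefix_ge0 n b : 0 <= ternary_prefix n b.
Proof. by elim: n b => //= n IH b; rewrite divr_ge0// addr_ge0. Qed.

(** The bound 1/2 is the sum of all 3^-(k+1), the fixed point of t -> (1 + t) / 3. *)
Lemma ternary_prefix_le n b : ternary_prefix n b <= 2^-1.
Proof.
elim: n b => [b|n IH b] /=; first by rewrite invr_ge0.
have := IH (b \o S); case: (b 0%N) => /=; lra.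
Qed.

Lemma nondecreasing_ternary_prefix b :
  nondecreasing_seq (fun n => ternary_prefix n b).
Proof.
apply/nondecreasing_seqP => n; elim: n b => [|n IH] b.
  exact: ternary_prefix_ge0.
by rewrite [leLHS]/= [leRHS]/= ler_pM2r// lerD2l.
Qed.

Definition ternary (b : nat -> bool) : R := limn (fun n => ternary_prefix n b).

Lemma cvg_ternary b : ternary_prefix n b @[n --> \oo] --> ternary b.
Proof.
apply: nondecreasing_is_cvgn; first exact: nondecreasing_ternary_prefix.
by exists 2^-1 => _ [n _ <-]; exact: ternary_prefix_le.
Qed.

Lemma ternary_ge0 b : 0 <= ternary b.
Proof.
apply: limr_ge; first exact: cvg_ternary.
by apply: nearW => n; exact: ternary_prefix_ge0.
Qed.

Lemma ternary_le b : ternary b <= 2^-1.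
Proof.
apply: limr_le; first exact: cvg_ternary.
by apply: nearW => n; exact: ternary_prefix_le.
Qed.

Lemma ternaryE b : ternary b = ((b 0%N)%:R + ternary (b \o S)) / 3.
Proof.
(* Starting the sequence at index 1 keeps its limit and lets the recursion unfold. *)
apply/cvg_lim => //; rewrite -(cvg_shiftS _).
by apply: cvgMl; apply: cvgD; [exact: cvg_cst|exact: cvg_ternary].
Qed.

(** If the first digit is 0, the rest contributes at most 1/6 < 1/3. This gap is the reason for base
    3: with digits 0 and 1 the expansion is unambiguous. *)
Lemma ternary_digit b : (3^-1 <= ternary b) = b 0%N.
Proof.
rewrite ternaryE; have := ternary_le (b \o S); have := ternary_ge0 (b \o S).
move: (ternary (b \o S)) => t; case: (b 0%N) => /= ge0 le.
  by rewrite ler_pdivlMr// mulVf// lerDl.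
by apply/negbTE; rewrite -ltNge; lra.
Qed.

(** On codes this deletes the first digit, which is read off by comparison with 1/3. *)
Definition ternary_shift (y : R) : R := y * 3 - (3^-1 <= y)%R%:R.

Lemma iter_ternary_shift n b :
  iter n ternary_shift (ternary b) = ternary (fun k => b (n + k)%N).
Proof.
elim: n => [|n IH]; first by congr ternary.
rewrite iterS IH /ternary_shift ternary_digit ternaryE addn0.
rewrite mulfVK// addrC addKr; congr ternary; apply/funext => k /=.
by rewrite addnS addSn.
Qed.

Lemma measurable_natr_bool d (T : measurableType d) (f : T -> bool) :
  measurable_fun setT f -> measurable_fun setT (fun x => (f x)%:R : R).
Proof.
move=> mf; rewrite (_ : (fun _ => _) = (fun x => if f x then 1 else 0 : R)).
  exact: measurable_fun_ifT.
by apply/funext => x; case: (f x).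
Qed.

Lemma measurable_ternary_shift : measurable_fun setT ternary_shift.
Proof.
apply: measurable_funB; first exact: measurable_funM.
apply: measurable_natr_bool; exact: measurable_fun_ler.
Qed.

Lemma measurable_ternary d (T : measurableType d) (f : T -> nat -> bool) :
  (forall n, measurable_fun setT (f ^~ n)) ->
  measurable_fun setT (ternary \o f).
Proof.
move=> mf; apply: (measurable_fun_cvg (h := fun n => ternary_prefix n \o f)).
  move=> n; elim: n f mf => [|n IH] f mf; first exact: measurable_cst.
  rewrite (_ : _ \o _ = fun x => ((f x 0%N)%:R +
    (ternary_prefix n \o (fun x => f x \o S)) x) / 3)//.
  apply: measurable_funM => //; apply: measurable_funD.
    exact: measurable_natr_bool.
  by apply: IH => k; exact: mf.
by move=> x _; exact: cvg_ternary.
Qed.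

End ternary_code.

Lemma ternary_encoding (R : realType) d (T : measurableType d)
    (C : nat -> set T) : (forall n, measurable (C n)) ->
  exists2 g : T -> R, measurable_fun setT g &
    exists2 D : nat -> set R, forall n, measurable (D n) &
      forall n, C n = g @^-1` D n.
Proof.
move=> mC; exists (@ternary R \o (fun x n => x \in C n)).
  apply: measurable_ternary => n; apply: (measurable_fun_bool true).
  by rewrite setTI (_ : _ @^-1` _ = C n)//; apply/seteqP; split => x /=; [exact: set_mem|exact: mem_set].
(* [D n] consists of the reals whose digit number [n], read after [n] shifts, is 1. *)
exists (fun n => iter n (@ternary_shift R) @^-1` `[3^-1, +oo[%classic).
  move=> n; rewrite -[X in measurable X]setTI.
  have mi : measurable_fun setT (iter n (@ternary_shift R)).
    elim: n => [|n IH]; first exact: measurable_id.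
    exact: measurableT_comp (@measurable_ternary_shift R) IH.
  by apply: mi => //; exact: measurable_itv.
move=> n; apply/seteqP.
by split => x /=; rewrite in_itv /= andbT iter_ternary_shift ternary_digit addn0;
  [exact: mem_set|exact: set_mem].
Qed.

(** * Reduction to countably many events and to a Borel set over the reals *)

Definition coordinate_events d (T : measurableType d) (E : finType)
    (C : nat -> set T) : set (set (power E T)) :=
  \bigcup_(e : E) preimage_set_system setT (fun w : power E T => w e) (range C).
Arguments coordinate_events {d T} E C _.

(** The sets [A] admitting such a family [C] contain the cylinders and form a sigma-algebra, since
    countably many sequences of events merge into one. *)
Lemma measurable_countably_generated d (T : measurableType d) (E : finType)
    (A : set (power E T)) : measurable A ->
  exists2 C : nat -> set T, forall n, measurable (C n) &
    <<s coordinate_events E C >> A.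
Proof.
move: A; apply: (@smallest_sub _ _ _ [set A | exists2 C : nat -> set T,
    forall n, measurable (C n) & <<s coordinate_events E C >> A]); last first.
  move=> _ [e _ [Y mY <-]]; exists (fun=> Y) => //.
  by apply: sub_sigma_algebra; exists e => //; exists Y => //; exists 0%N.
split=> [|B [C mC CB]|F mF].
- by exists (fun=> set0) => //; exact: sigma_algebra0.
- by exists C => //; rewrite setTD; exact: sigma_algebraC.
have /choice[C HC] n : exists C : nat -> set T,
    (forall m, measurable (C m)) /\ <<s coordinate_events E C >> (F n).
  by have [C mC CF] := mF n; exists C.
(* The double sequence is enumerated through a coding of pairs; indices that code no pair get the
   empty set. *)
exists (fun k => if unpickle k is Some (n, m) then C n m else set0) => [k|].
  by case: unpickle => [[n m]|//]; case: (HC n).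
apply: sigma_algebra_bigcup => n.
case: (HC n) => _; apply: (smallest_sub (smallest_sigma_algebra _ _)).
move=> _ [e _ [_ [m _ <-] <-]].
apply: sub_sigma_algebra; exists e => //; exists (C n m) => //.
by exists (pickle (n, m)) => //; rewrite pickleK.
Qed.

(** With [C] and its code [g] fixed, pullbacks along [g] form a sigma-algebra, and it contains the
    generating coordinate events because each [C n] is the pullback of [D n]. *)
Lemma measurable_pullback (R : realType) d (T : measurableType d) (E : finType)
    (A : set (power E T)) : measurable A ->
  exists2 g : T -> R, measurable_fun setT g &
    exists2 A' : set (power E R), measurable A' & A = power_map g @^-1` A'.
Proof.
move=> /measurable_countably_generated[C mC CA].
have [g mg [D mD CD]] := ternary_encoding R mC; exists g => //.
move: A CA; apply: (@smallest_sub _ _ _ [set A |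
    exists2 A' : set (power E R), measurable A' & A = power_map g @^-1` A']); last first.
  move=> _ [e _ [_ [n _ <-] <-]]; exists ((fun w : power E R => w e) @^-1` D n).
    by rewrite -[X in measurable X]setTI; exact: (measurable_coord e).
  by rewrite setTI CD.
split=> [|B [B' mB' ->]|F mF].
- by exists set0.
- by exists (~` B'); [exact: measurableC|rewrite setTD preimage_setC].
have /choice[F' HF] n : exists F' : set (power E R),
    measurable F' /\ F n = power_map g @^-1` F'.
  by have [F' mF' FF'] := mF n; exists F'.
exists (\bigcup_n F' n).
  by apply: bigcup_measurable => n _; case: (HF n).
by rewrite preimage_bigcup; apply: eq_bigcupr => n _; case: (HF n).
Qed.

(** * Laws on the real line and the quantile function *)

Lemma probability_eq_rays (R : realType) (mu nu : probability R R) :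
  (forall y : R, mu `]-oo, y]%classic = nu `]-oo, y]%classic) ->
  forall D, measurable D -> mu D = nu D.
Proof.
(* The rays ]x, +oo[ form a generating pi-system, and their measures are the complements of the
   given ones. *)
move=> munu; apply: (measure_unique (@RGenOInfty.G R)
  (fun n => `]- n%:R, +oo[%classic)) => //.
- exact: RGenOInfty.measurableE.
- move=> _ _ [x ->] [y ->]; exists (Order.max x y).
  apply/seteqP; split => z /=; rewrite !in_itv /= !andbT gt_max; first by case=> -> ->.
  by case/andP.
- by move=> n; exists (- n%:R).
- apply/seteqP; split => // z _; exists (Num.truncn `|z|).+1 => //=.
  by rewrite in_itv /= andbT ltrNl (le_lt_trans (ler_norm _))// normrN truncnS_gt.
- have rayE (m : probability R R) x :
      m `]x, +oo[%classic = (1 - m `]-oo, x]%classic)%E.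
    by rewrite -setCitvl probability_setC.
  by move=> _ [x ->]; rewrite [LHS]rayE [RHS]rayE munu.
- by move=> n; rewrite -ge0_fin_numE// fin_num_measure.
Qed.

Lemma measurable_set_val (R : realType) :
  measurable_fun setT (set_val : unit_interval R -> R).
Proof.
apply: (measurability _ (RGenOInfty.measurableE R)) => _ [_ [x ->] <-].
rewrite setTI; apply: sub_sigma_algebra.
by exists `]x, +oo[%classic; first exact: interval_open.
Qed.

Section quantile.
Context (R : realType) (mu : probability R R).

Let F (y : R) : R := fine (mu `]-oo, y]%classic).

Let F_nd : {homo F : x y / x <= y}.
Proof.
move=> x y xy; rewrite /F fine_le ?fin_num_measure// le_measure ?inE//.
exact: subitvPr.
Qed.

Let F01 y : 0 <= F y <= 1.
Proof.
by rewrite -!lee_fin /F fineK ?fin_num_measure// measure_ge0 probability_le1.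
Qed.

(** The identity has law [mu], so general facts on distribution functions of random variables apply
    to [F]. *)
Let X : {RV mu >-> R} := HB.pack (idfun : R -> R)
  (isMeasurableFun.Build _ _ _ _ (idfun : R -> R) (@measurable_id _ _ setT)).

Let F_y : F y @[y --> +oo] --> (1 : R).
Proof. exact/fine_cvg/(cvg_cdfy1 X). Qed.

Let F_Ny : F y @[y --> -oo] --> (0 : R).
Proof. exact/fine_cvg/(cvg_cdfNy0 X). Qed.

Let F_right x : F y @[y --> x^'+] --> F x.
Proof.
apply: fine_cvg; rewrite /F fineK ?fin_num_measure//.
exact: (cdf_right_continuous (X := X)).
Qed.

Let level (u : R) : set R := [set y | u <= F y].

Let level_nonempty (u : R) : u < 1 -> level u !=set0.
Proof.
move=> u1; have /filter_ex[y uy] : \forall y \near +oo, u < F y by exact: cvgr_gt F_y _ u1.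
by exists y; exact: ltW.
Qed.

Let level_lbound (u : R) : 0 < u -> has_lbound (level u).
Proof.
move=> u0; have /filter_ex[y yu] : \forall y \near -oo, F y < u by exact: cvgr_lt F_Ny _ u0.
exists y => z /= uz; rewrite leNgt; apply/negP => /ltW/F_nd.
by rewrite leNgt (lt_le_trans yu).
Qed.

(* The set [level u] is an interval closed on the left because [F] is
   right-continuous. *)
Let inf_level_le (u y : R) : 0 < u < 1 -> (inf (level u) <= y) = (u <= F y).
Proof.
move=> /andP[u0 u1]; apply/idP/idP => [|uy]; last exact: (ge_inf (level_lbound u0)).
apply: contraTT; rewrite -!ltNge => yu.
have : \forall z \near y^'+, F z < u /\ y < z.
  near=> z; split; last by near: z; exact: nbhs_right_gt.
  by near: z; exact: cvgr_lt (@F_right y) _ yu.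
move=> /(@filter_ex _ _ (at_right_proper_filter y))[z [zu yz]].
apply: (lt_le_trans yz); apply: lb_le_inf; first exact: level_nonempty.
move=> t /= ut; rewrite leNgt; apply/negP => /ltW/F_nd.
by rewrite leNgt (lt_le_trans zu).
Unshelve. all: by end_near. Qed.

(** For [u <= 0] the set [level u] is unbounded below, and for [u >= 1] it may be empty, hence the
    default 0. Within [0, 1] only the two endpoints are affected, a null set. *)
Definition quantile (u : R) : R := if 0 < u < 1 then inf (level u) else 0.

(** The second term records the default value 0, which lies in the ray exactly when [0 <= y]. *)
Let quantile_preimage y : quantile @^-1` `]-oo, y] =
  (`]0, 1[ `&` `]-oo, F y]) `|` (if 0 <= y then ~` `]0, 1[ else set0).
Proof.
apply/seteqP; rewrite /quantile; split => u /=; rewrite !in_itv /=.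
  case: ifPn => u01; first by rewrite inf_level_le//; left.
  by move=> ->; right; rewrite /= in_itv; apply/negP.
case=> [[u01 uF]|]; first by rewrite u01 inf_level_le.
by case: ifPn => // y0; rewrite /= in_itv /= => /negP/negbTE ->.
Qed.

Lemma measurable_quantile : measurable_fun setT quantile.
Proof.
apply: (measurability _ (RGenOInfty.measurableE R)) => //.
move=> _ [_ [y ->] <-]; rewrite setTI -setCitvl -preimage_setC quantile_preimage.
apply: measurableC; apply: measurableU; first exact: measurableI.
by case: ifPn => // _; exact: measurableC.
Qed.

(** It suffices to treat rays. The points of [0, 1] sent into ]-oo, y] contain ]0, F
    y[ and lie in ]0, F y] together with {0, 1}; both bounds have length [F y]. *)
Lemma quantile_law D : measurable D ->
  mu D = @unit_lebesgue R ((quantile \o set_val) @^-1` D).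
Proof.
have mq : measurable_fun setT (quantile \o set_val : unit_interval R -> R).
  exact: measurableT_comp measurable_quantile (@measurable_set_val R).
pose q : {mfun unit_interval R >-> R} :=
  HB.pack (quantile \o set_val : unit_interval R -> R)
    (isMeasurableFun.Build _ _ _ _ _ mq).
pose nu : probability R R := distribution (@unit_lebesgue R) q.
move: D; apply: (@probability_eq_rays _ mu nu) => y.
rewrite -[LHS]fineK ?fin_num_measure// -/(F y).
rewrite /nu /= /distribution /pushforward /unit_lebesgue.
set L := set_val @` _.
have mL : measurable L.
  apply: measurable_unit_interval; rewrite -[X in measurable X]setTI.
  exact: (mq).
(* [b] selects an open ([true]) or closed ([false]) right end; if [F y] is 0 the interval is
   empty. *)
have lebF b : (F y)%:E =
    lebesgue_measure [set` Interval (BRight (0 : R)) (BSide b (F y))].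
  rewrite lebesgue_measure_itv /= lte_fin; case: ltP => [|F0].
    by rewrite oppr0 adde0.
  by congr EFin; apply/eqP; rewrite eq_le F0; case/andP: (F01 y).
apply/eqP; rewrite eq_le; apply/andP; split.
  (* With the right end open, u < F y <= 1 keeps u away from the endpoint 1, where [quantile] takes
     its default value. *)
  rewrite (lebF true).
  apply: le_measure; rewrite ?inE// => u /=; rewrite in_itv /= => /andP[u0 uF].
  have u1 : u < 1 by apply: (lt_le_trans uF); case/andP: (F01 y).
  have uI : u \in `[0, 1]%classic by rewrite inE /= in_itv /= !ltW.
  exists (exist _ u uI) => //=.
  by rewrite in_itv /= /quantile u0 u1 /= inf_level_le ?u0// ltW.
have m01 : measurable [set (0 : R); 1] by exact: measurableU.
have -> : (F y)%:E = lebesgue_measure (`]0, (F y)] `|` [set (0 : R); 1]).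
  rewrite (lebF false); apply/esym; apply: measureU0 => //.
  exact/countable_lebesgue_measure0/finite_set_countable/finite_set2.
apply: le_measure; rewrite ?inE//.
  exact: measurableU.
move=> _ [v + <-]; have := set_valP v; rewrite /= !in_itv /= /quantile.
move=> /andP[v0 v1].
case: ifPn => [v01|]; first by rewrite inf_level_le// => ->; left; case/andP: v01 => ->.
rewrite negb_and -!leNgt => /orP[v0'|v1'] _; right.
  by left; apply/eqP; rewrite eq_le v0 v0'.
by right; apply/eqP; rewrite eq_le v1 v1'.
Qed.

End quantile.

Theorem theorem2p4 (R : realType) (d : measure_display) (T : measurableType d)
    (P : probability T R) (E : finType) (h : R -> R)
    (h01 : forall x : R, 0 <= x <= 1 -> 0 <= h x <= 1)
    (mh : measurable_fun (`[0, 1]%classic : set R) h)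
    (A : set (power E T)) (mA : measurable A) :
  exists B : set (power E (unit_interval R)),
    [/\ measurable B,
        power_prob (@unit_lebesgue R) E B = power_prob P E A
      & forall e : E,
          influence (@unit_lebesgue R) h B e = influence P h A e].
Proof.
have [g mg [A' mA' ->]] := measurable_pullback R mA.
pose G : {mfun T >-> R} := HB.pack g (isMeasurableFun.Build _ _ _ _ _ mg).
pose mu : probability R R := distribution P G.
have mq : measurable_fun setT (quantile mu \o set_val : unit_interval R -> R).
  exact: measurableT_comp (measurable_quantile mu) (@measurable_set_val R).
exists (power_map (quantile mu \o set_val : unit_interval R -> R) @^-1` A'); split.
- by rewrite -[X in measurable X]setTI; exact: measurable_power_map.
(* Both events are pullbacks of [A'], so each side equals the probability of [A'] under the power of
   [mu]; influences are compared in the same way. *)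
- rewrite -(power_prob_map (P := mu) mq (quantile_law mu))//.
  exact: (power_prob_map (P := mu) mg).
move=> e; rewrite (influence_map (P := mu) mq (quantile_law mu))//.
by rewrite (influence_map (P := mu) mg).
Qed.
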